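(* Let $M$ be a matroid and let $m,n$ be positive integers. Let $A$ be an $m\times n$ matrix whose entries are elements of $M$, and suppose that for each row of $A$, the set of entries of that row is an independent set of size $n$ in $M$ (in particular the entries within a row are distinct). If $m\ge 2n-1$, then $A$ has an independent transversal, i.e., there exist $n$ entries of $A$, lying in $n$ distinct rows and in $n$ distinct columns (so one in each column), which are distinct elements of $M$ and which together form an independent set in $M$. *)

(* Defs.v *)
From mathcomp Require Import all_boot all_order all_algebra.

Set Implicit Arguments.
Unset Strict Implicit.
Unset Printing Implicit Defensive.

(* The ground set is the whole finite type E. *)
Record matroid (E : finType) := Matroid {
  indep : pred {set E};
  indep_set0 : indep set0;
  indep_subset : forall I J : {set E}, I \subset J -> indep J -> indep I;
  indep_augment : forall I J : {set E}, indep I -> indep J -> #|I| < #|J| ->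
    exists2 x, x \in J :\: I & indep (x |: I)
}.

Definition row_entries (E : finType) (m n : nat) (A : 'M[E]_(m, n)) (i : 'I_m)
  : {set E} := [set A i j | j : 'I_n].

(* S is a set of positions (row, column).  Positions are distinguished from the
   elements they hold, so distinctness of the entries is a separate clause. *)
Definition independent_transversal (E : finType) (M : matroid E) (m n : nat)
    (A : 'M[E]_(m, n)) (S : {set 'I_m * 'I_n}) : Prop :=
  [/\ #|S| = n,
      {in S &, injective (fun p => p.1)},
      {in S &, injective (fun p => p.2)},
      {in S &, injective (fun p => A p.1 p.2)}
    & indep M [set A p.1 p.2 | p in S]].

(* Main.v *)
(** Suppose a partial independent transversal [f] covers all columns of [B] but
    [d0], with set of entries [T].  Call a column [d] of [B] freeable if [f] can
    be modified into a partial transversal covering [B :\ d] whose entries are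
    spanned by [T].  If [D] consists of freeable columns and contains [d0], look
    at the entries [x_d], [d \in D], of an unused row.  If some [x_d] is not
    spanned by [T], then adding it covers [B].  Otherwise these [#|D|]
    independent elements cannot all be spanned by the [#|D| - 1] entries of [f]
    on [D :\ d0], so the fundamental circuit in [T] of some [x_d] meets a column
    outside [D], which is then freeable by exchange.  Each new row thus enlarges
    [D], which cannot outgrow [B]. *)
Require Import Defs.
From mathcomp Require Import all_boot all_order all_algebra.
From mathcomp Require Import zify.

Set Implicit Arguments.
Unset Strict Implicit.
Unset Printing Implicit Defensive.

(** * Spanning and circuits in a matroid *)

Section Span.

Variables (E : finType) (M : matroid E).
Implicit Types (x y : E) (I J K T : {set E}).

(* Meaningful as membership in the closure of [I] only for independent [I]. *)
Definition spans I x := (x \in I) || ~~ indep M (x |: I).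

Lemma spansN I x : ~~ spans I x -> x \notin I /\ indep M (x |: I).
Proof. by rewrite negb_or negbK => /andP. Qed.

Lemma spans_mem I x : x \in I -> spans I x.
Proof. by rewrite /spans => ->. Qed.

Lemma spans_sub I J x : I \subset J -> spans I x -> spans J x.
Proof.
move=> sIJ /orP[xI|nI]; first by rewrite spans_mem // (subsetP sIJ).
by apply/orP; right; apply: contra nI; apply/indep_subset/setUS.
Qed.

Lemma card_spans I K : indep M I -> indep M K -> {in K, forall x, spans I x} ->
  #|K| <= #|I|.
Proof.
move=> iI iK sK; rewrite leqNgt; apply/negP => ltIK.
have [y /setDP[yK yI] iy] := indep_augment iI iK ltIK.
by move: (sK _ yK); rewrite /spans (negPf yI) iy.
Qed.

Lemma indep_extend I J : indep M I -> indep M J -> #|I| <= #|J| ->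
  exists K, [/\ indep M K, I \subset K, K \subset I :|: J & #|K| = #|J|].
Proof.
move=> iI iJ; move: {-2}(#|J| - #|I|) (erefl (#|J| - #|I|)) => k.
elim: k I iI => [|k IH] I iI dk leIJ.
  exists I; split; rewrite ?subsetUl //; lia.
have ltIJ : #|I| < #|J| by lia.
have [y /setDP[yJ yI] iy] := indep_augment iI iJ ltIJ.
have cy : #|y |: I| = #|I|.+1 by rewrite cardsU1 yI.
have [||K [iK sIK sKJ cK]] := IH _ iy; try lia.
exists K; split=> //; first exact: subset_trans (subsetUr _ _) sIK.
by apply: subset_trans sKJ _; rewrite !subUset sub1set !inE yJ orbT subsetUl subsetUr.
Qed.

(** If [I] did not span [x], then [J] could be extended by elements of [x |: I] to an independent
    [K] of size [#|I| + 1]. Since [J] spans [x], [K] avoids [x], so [I] spans [K] and [K] is too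
    large. *)
Lemma spans_trans I J x : indep M I -> indep M J ->
  {in J, forall y, spans I y} -> spans J x -> spans I x.
Proof.
move=> iI iJ sJ Jx; apply/negPn/negP => nIx; have [xI ix] := spansN nIx.
have leJI := card_spans iI iJ sJ.
have cx : #|x |: I| = #|I|.+1 by rewrite cardsU1 xI.
have [|K [iK sJK sK cK]] := indep_extend iJ ix; first lia.
have xK : x \notin K.
  apply/negP => xK; case/orP: Jx => [xJ|]; first by rewrite sJ in nIx.
  by rewrite (indep_subset _ iK) // subUset sub1set xK.
suff: #|K| <= #|I| by lia.
apply: card_spans => // y yK; move: (subsetP sK _ yK); rewrite !inE.
case/or3P=> [/sJ //|/eqP yx|yI]; first by rewrite -yx yK in xK.
exact: spans_mem.
Qed.

(* The spanning set on the right is the fundamental circuit of [x] minus [x]. *)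
Lemma spans_circuit T x : indep M T -> spans T x ->
  spans [set y in T | ~~ spans (T :\ y) x] x.
Proof.
move=> iT Tx.
(* Suppose [T :\ y] spans [x] for some [y] in a minimal [W] spanning [x]. Then [T :\ y] spans
   [x |: W :\ y], which spans [y] by exchange, against the independence of [T]. *)
have [W /minsetP[Wx minW] sWT] := @minset_exists _ (fun W => spans W x) T Tx.
apply: (spans_sub _ Wx); apply/subsetP => y yW; rewrite inE (subsetP sWT) //=.
apply/negP => Tyx; have nWy : ~~ spans (W :\ y) x.
  apply/negP => /minW/(_ (subD1set _ _))/setP/(_ y).
  by rewrite !inE eqxx yW.
have [xWy ix] := spansN nWy.
have iTy : indep M (T :\ y) by apply: indep_subset iT; apply: subD1set.
have: spans (T :\ y) y; last first.
  by rewrite /spans !inE eqxx /= setD1K ?iT // (subsetP sWT).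
apply: (@spans_trans _ (x |: W :\ y)) => //.
  move=> z; rewrite 2!inE => /orP[/eqP->//|zW]; apply: spans_mem.
  by apply: subsetP zW; apply: setSD.
have [->|nyx] := eqVneq y x; first by rewrite spans_mem // setU11.
apply/orP; right; rewrite setUCA setD1K //.
by move: Wx; rewrite /spans; move: xWy; rewrite !inE eq_sym nyx /= => /negPf->.
Qed.

End Span.

(** * Partial transversals and freeable columns *)

Section Transversal.

Variables (E : finType) (M : matroid E) (m n : nat) (A : 'M[E]_(m, n)).
Hypothesis row_indep : forall i : 'I_m,
  indep M (row_entries A i) /\ #|row_entries A i| = n.
Implicit Types (f g : 'I_n -> 'I_m) (X Y B D : {set 'I_n}) (Q : {set 'I_m}).

Definition entries f X := [set A (f c) c | c in X].

(** Choosing a row for each column makes distinctness of columns automatic; the values of [f]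
    outside [X] are irrelevant. *)
Definition transversal_on X f :=
  [/\ {in X &, injective f}, {in X &, injective (fun c => A (f c) c)}
    & indep M (entries f X)].

Definition update f d r c := if c == d then r else f c.

Lemma transversal_on_sub X B f :
  X \subset B -> transversal_on B f -> transversal_on X f.
Proof.
move=> /[dup] sXB /subsetP sub [If Ie iB]; split.
- by move=> a b /sub aB /sub bB; apply: If.
- by move=> a b /sub aB /sub bB; apply: Ie.
- exact: indep_subset (imsetS _ sXB) iB.
Qed.

Lemma transversal_on_update X f d r : transversal_on X f -> d \notin X ->
  {in X, forall c, f c != r} -> ~~ spans M (entries f X) (A r d) ->
  transversal_on (d |: X) (update f d r).
Proof.
move=> [If Ie iX] dX fr /spansN[nr ir].
have ud : update f d r d = r by rewrite /update eqxx.
have uX c : c \in X -> update f d r c = f c.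
  by rewrite /update; case: eqP => // ->; rewrite (negPf dX).
have eX c : c \in X -> A (f c) c != A r d.
  by move=> cX; apply: contraNneq nr => <-; apply: imset_f.
split.
- move=> a b /setU1P[->|aX] /setU1P[->|bX] //; rewrite ?ud ?uX //.
  + by move/esym/eqP; rewrite (negPf (fr _ bX)).
  + by move/eqP; rewrite (negPf (fr _ aX)).
  + exact: If.
- move=> a b /setU1P[->|aX] /setU1P[->|bX] //; rewrite ?ud ?uX //.
  + by move/esym/eqP; rewrite (negPf (eX _ bX)).
  + by move/eqP; rewrite (negPf (eX _ aX)).
  + exact: Ie.
- rewrite /entries imsetU1 ud.
  by have -> : [set A (update f d r c) c | c in X] = entries f X
    by apply: eq_in_imset => c /uX->.
Qed.

Lemma row_inj i : injective (A i).
Proof.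
apply/injectiveP/card_uniqP.
rewrite size_map -cardT card_ord -[RHS](row_indep i).2.
by apply: eq_card => x; apply/idP/imsetP => [/codomP[j ->]|[j _ ->]];
  [exists j|apply: codom_f].
Qed.

Lemma row_sub_indep i X : indep M [set A i c | c in X].
Proof. by apply: indep_subset (row_indep i).1; apply/imsetS/subsetP. Qed.

(* The columns of [D] can be freed using only rows of [Q]; see the header. *)
Definition freeable f B d0 Q D :=
  [/\ d0 \in D, D \subset B & forall d, d \in D -> exists g,
    [/\ transversal_on (B :\ d) g, {in B :\ d, forall b, g b \in Q},
        {in B :\: D, g =1 f}
      & {in D :\ d, forall b, spans M (entries f (D :\ d0)) (A (g b) b)}]].

(** * Enlarging the set of freeable columns *)

Section Step.

Variables (f : 'I_n -> 'I_m) (B : {set 'I_n}) (d0 : 'I_n).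
Hypotheses (d0B : d0 \in B) (fT : transversal_on (B :\ d0) f).

Let T := entries f (B :\ d0).

Lemma entries_indep X : X \subset B :\ d0 -> indep M (entries f X).
Proof. by move=> sX; case: (transversal_on_sub sX fT). Qed.

(** Distinct columns carry distinct entries, so circuits in [T] can be read as sets of columns. *)
Lemma entriesD1 c : c \in B :\ d0 -> T :\ A (f c) c = entries f (B :\ d0 :\ c).
Proof.
case: fT => _ Ie _ cC; apply/setP => x; apply/setD1P/imsetP.
  case=> nx /imsetP[b bC dx]; exists b => //; rewrite in_setD1 bC andbT.
  by apply: contraNneq nx => <-; rewrite dx.
case=> b /setD1P[nbc bC] ->; split; last exact: imset_f.
by apply: contraNneq nbc => /Ie->.
Qed.

(* [X] is [B :\ d] when augmenting and [B :\ d :\ c] when freeing [c]. *)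
Lemma freeable_update D Q d g r X Y : d0 \in D -> d \in D -> r \notin Q ->
  transversal_on (B :\ d) g -> {in B :\ d, forall b, g b \in Q} ->
  {in B :\: D, g =1 f} ->
  {in D :\ d, forall b, spans M (entries f (D :\ d0)) (A (g b) b)} ->
  X \subset B :\ d -> D :\ d0 \subset Y -> X :\: D \subset Y ->
  Y \subset B :\ d0 -> ~~ spans M (entries f Y) (A r d) ->
  transversal_on (d |: X) (update g d r).
Proof.
move=> d0D dD rQ gT gQ gf gs sX sDY sXY sY nr.
have XT := transversal_on_sub sX gT.
apply: transversal_on_update => //.
- by apply/negP => /(subsetP sX); rewrite !inE eqxx.
- by move=> c /(subsetP sX) /gQ; apply: contraTneq => ->.
(* The entries of [f] on [Y] span those of [g] on [X]: inside [D] by [gs], outside because [g]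
   agrees with [f]. *)
apply: contra nr; apply: spans_trans.
- exact: entries_indep.
- by case: XT.
move=> _ /imsetP[b bX ->]; have /setD1P[nbd bB] := subsetP sX _ bX.
have [bD|bD] := boolP (b \in D).
  by apply: spans_sub (gs b _); [apply: imsetS|rewrite !inE nbd].
rewrite gf ?inE ?bD //; apply/spans_mem/imset_f.
by apply: subsetP sXY _ _; rewrite inE bD.
Qed.

Lemma freeable_step Q D r : freeable f B d0 Q D -> r \notin Q ->
  (exists g, transversal_on B g) \/
  exists2 D', freeable f B d0 (r |: Q) D' & #|D| < #|D'|.
Proof.
move=> [d0D sDB frD] rQ.
have [/existsP[d /andP[dD nd]]|/existsPn allT] :=
  boolP [exists d, (d \in D) && ~~ spans M T (A r d)].
  left; have [g [gT gQ gf gs]] := frD d dD.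
  exists (update g d r); rewrite -(setD1K (subsetP sDB _ dD)).
  apply: (freeable_update (Y := B :\ d0) d0D dD rQ gT gQ gf gs) => //.
    exact: setSD.
  apply/subsetP => b; rewrite !inE => /and3P[bD _ ->]; rewrite andbT.
  by apply: contraNneq bD => ->.
right.
have spT d : d \in D -> spans M T (A r d).
  by move=> dD; move: (allT d); rewrite dD negbK.
(* The new columns are those outside [D] met by the fundamental circuit in [T] of some [A r d] with
   [d] in [D]. *)
pose D' := D :|: [set c in B :\: D |
  [exists d in D, ~~ spans M (entries f (B :\ d0 :\ c)) (A r d)]].
have sDD' : D \subset D' by apply: subsetUl.
have sD'B : D' \subset B.
  by rewrite subUset sDB; apply/subsetP => c; rewrite !inE => /andP[/andP[]].
have spD' d : d \in D -> spans M (entries f (D' :\ d0)) (A r d).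
  move=> dD; case: (fT) => _ _ iT.
  apply: spans_sub (spans_circuit iT (spT d dD)).
  apply/subsetP => _ /setIdP[/imsetP[c cC ->]].
  rewrite entriesD1 // => nc; apply: imset_f.
  move: cC; rewrite !inE => /andP[-> ->]; case: (c \in D) => //=.
  by apply/existsP; exists d; rewrite dD.
have ltDD' : #|D| < #|D'|.
  apply: proper_card; rewrite properEneq sDD' andbT; apply/eqP => eDD'.
  suff: #|[set A r d | d in D]| <= #|entries f (D :\ d0)|.
    rewrite card_imset; last exact: row_inj.
    have := leq_imset_card (fun c => A (f c) c) (mem (D :\ d0)).
    rewrite -/(entries _ _); have := cardsD1 d0 D; rewrite d0D.
    by move=> -> h1 h2; have := leq_trans h2 h1; rewrite add1n ltnn.
  apply: (card_spans (M := M)) (row_sub_indep _ _) _.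
    exact/entries_indep/setSD.
  by move=> _ /imsetP[d dD ->]; rewrite {1}eDD'; apply: spD'.
have spg d g b : d \in D -> {in B :\: D, g =1 f} ->
    {in D :\ d, forall b, spans M (entries f (D :\ d0)) (A (g b) b)} ->
    b \in D' -> b != d -> spans M (entries f (D' :\ d0)) (A (g b) b).
  move=> dD gf gs bD' nbd; have [bD|bD] := boolP (b \in D).
    apply: spans_sub (gs b _); first exact/imsetS/setSD.
    by rewrite !inE nbd.
  rewrite gf ?inE ?bD ?(subsetP sD'B) //; apply/spans_mem/imset_f.
  by rewrite in_setD1 bD' andbT; apply: contraNneq bD => ->.
exists D' => //; split=> //; first exact: subsetP d0D.
move=> c cD'; have [cD|cD] := boolP (c \in D).
  have [g [gT gQ gf gs]] := frD c cD; exists g; split=> //.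
  - by move=> b /gQ; rewrite inE orbC => ->.
  - by move=> b /setDP[bB bD']; apply: gf; rewrite inE bB andbT;
      apply: contra bD'; apply: subsetP.
  - by move=> b /setD1P[nbc bD']; apply: spg bD' nbc.
move: (cD'); rewrite !inE (negPf cD) /=.
case/andP=> cB /existsP[d /andP[dD nd]].
have [g [gT gQ gf gs]] := frD d dD.
have ndc : d != c by apply: contraNneq cD => <-.
have eB : B :\ c = d |: (B :\ d :\ c).
  apply/setP => b; rewrite !inE; have [->|] //= := eqVneq b d.
  by rewrite ndc (subsetP sDB).
(* Dropping column [c] makes room for [A r d] in the column [d] left free by [g]. *)
exists (update g d r); split.
- rewrite eB.
  apply: (freeable_update (Y := B :\ d0 :\ c) d0D dD rQ gT gQ gf gs) => //.
  + exact: subD1set.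
  + apply/subsetP => b; rewrite !inE => /andP[-> bD].
    by rewrite (subsetP sDB) // !andbT; apply: contraNneq cD => <-.
  + apply/subsetP => b; rewrite !inE => /and4P[bD -> _ ->]; rewrite andbT /=.
    by apply: contraNneq bD => ->.
  + exact: subD1set.
- move=> b /setD1P[_ bB]; rewrite /update in_setU1.
  by have [//|nbd] := eqVneq b d; rewrite ?eqxx // gQ ?orbT // !inE nbd.
- move=> b /setDP[bB bD']; rewrite /update.
  have bD : b \notin D by apply: contra bD'; apply: subsetP.
  case: eqVneq => [bd|_]; first by rewrite bd dD in bD.
  by apply: gf; rewrite inE bD.
- move=> b /setD1P[_ bD']; rewrite /update.
  by case: eqVneq => [->|nbd]; [apply: spD'|apply: spg bD' nbd].
Qed.

Lemma transversal_on_augment :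
  2 * #|B| - 1 <= m -> exists g, transversal_on B g.
Proof.
move=> leBm; have cB := cardsD1 d0 B; rewrite d0B in cB.
(* [Q] starts with the at most [#|B| - 1] rows of [f] and gains one per round. A last round from
   [k = #|B| - 1] still finds a row outside [Q], as [#|Q| <= 2 * #|B| - 2 < m]. At [k = #|B|], [D]
   would outgrow [B]. *)
have H k : k <= #|B| -> (exists g, transversal_on B g) \/
    exists Q D, [/\ freeable f B d0 Q D, #|Q| <= #|B|.-1 + k & k < #|D|].
  elim: k => [_|k IH ltkB].
    right; exists (f @: (B :\ d0)), [set d0]; split; last by rewrite cards1.
      split; rewrite ?inE ?sub1set // => d /set1P->; exists f; split=> //.
        by move=> b bC; apply: imset_f.
      by move=> b; rewrite setDv inE.
    by rewrite cB addn0 leq_imset_card.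
  have [|[Q [D [frD leQ ltD]]]] := IH (ltnW ltkB); [by left|].
  have /subsetPn[r _ rQ] : ~~ ([set: 'I_m] \subset Q).
    by apply/negP => /subset_leq_card; rewrite cardsT card_ord; lia.
  have [|[D' frD' ltDD']] := freeable_step frD rQ; [by left|right].
  exists (r |: Q), D'; split=> //; last lia.
  by rewrite cardsU1 rQ; lia.
have [//|[Q [D [[_ sDB _] _ ltD]]]] := H _ (leqnn _).
by have := subset_leq_card sDB; lia.
Qed.

End Step.

Lemma transversal_on_exists B :
  0 < m -> 2 * #|B| - 1 <= m -> exists f, transversal_on B f.
Proof.
move=> m_gt0; move: {-2}(#|B|) (erefl #|B|) => k.
elim: k B => [|k IH] B cB leBm.
  have -> : B = set0 by apply/eqP; rewrite -cards_eq0 -cB.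
  (* Even for empty [B] the total function needs a default row, which the bound on [m] does not
     supply here. *)
  exists (fun=> Ordinal m_gt0); split; try by move=> ? ?; rewrite inE.
  by rewrite /entries imset0 indep_set0.
have /card_gt0P[d0 d0B] : 0 < #|B| by rewrite -cB.
have [||f fT] := IH (B :\ d0); try by have := cardsD1 d0 B; rewrite d0B; lia.
by apply: (transversal_on_augment d0B fT); rewrite -cB.
Qed.

End Transversal.

Theorem theorem2 (E : finType) (M : matroid E) (m n : nat)
    (m_gt0 : 0 < m) (n_gt0 : 0 < n) (A : 'M[E]_(m, n))
    (row_indep : forall i : 'I_m,
       indep M (row_entries A i) /\ #|row_entries A i| = n)
    (le_m : 2 * n - 1 <= m) :
  exists S : {set 'I_m * 'I_n}, independent_transversal M A S.
Proof.
have [|f [If Ie iT]] :=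
  transversal_on_exists row_indep (B := [set: 'I_n]) m_gt0.
  by rewrite cardsT card_ord.
exists [set (f c, c) | c : 'I_n]; split.
- by rewrite card_imset ?card_ord // => a b [].
- by move=> _ _ /imsetP[a _ ->] /imsetP[b _ ->] /= /If->; rewrite ?inE.
- by move=> _ _ /imsetP[a _ ->] /imsetP[b _ ->] /= ->.
- by move=> _ _ /imsetP[a _ ->] /imsetP[b _ ->] /= /Ie->; rewrite ?inE.
- rewrite -imset_comp; apply: indep_subset iT; apply/subsetP => x.
  by move=> /imsetP[c _ ->]; apply: imset_f; rewrite inE.
Qed.
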